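(* Let $A$ be a commutative ring with $1\ne0$, and let $\phi:R_3[\frac{1}{\Delta_x\Delta_y}]\to A$ be a ring homomorphism with $z_i\mapsto P_i\in A^2$ for $i=1,2,3$. If $e(P_1)=e(P_2)=e(P_3)=0$, then $$(P_1\oplus_0P_2)\oplus_0P_3=P_1\oplus_0(P_2\oplus_0P_3).$$
   Context: All rings are commutative with $1\neq0$. Let $R_3=\mathbb{Z}[c,d][x_1,y_1,x_2,y_2,x_3,y_3]$ (polynomial ring) and $z_i=(x_i,y_i)$. For an element $\delta$ of an integral domain $R$, $R[\frac1\delta]$ is the localization of $R$ at $\{1,\delta,\delta^2,\dots\}$. Let $e(x,y)=x^2+cy^2-1-dx^2y^2$; for $P_i=\phi(z_i)$ (applied coordinatewise), $e(P_i)\in A$ denotes $\phi(e(x_i,y_i))$. Define the rational functions $$(x_1,y_1)\oplus_0(x_2,y_2)=\left(\frac{x_1x_2-cy_1y_2}{1-dx_1x_2y_1y_2},\frac{x_1y_2+y_1x_2}{1+dx_1x_2y_1y_2}\right),$$ and $\delta_x(x_1,y_1,x_2,y_2)=1-dx_1y_1x_2y_2$, $\delta_y(x_1,y_1,x_2,y_2)=1+dx_1y_1x_2y_2$, $\delta=\delta_x\delta_y$, and let $\delta_{ij}=\delta(x_i,y_i,x_j,y_j)$. Let $(x_3',y_3')=(x_1,y_1)\oplus_0(x_2,y_2)$ and $(x_1',y_1')=(x_2,y_2)\oplus_0(x_3,y_3)$, and set $$\Delta_x=\delta_x(x_3',y_3',x_3,y_3)\,\delta_x(x_1,y_1,x_1',y_1')\,\delta_{12}\,\delta_{23}\in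 R_3,$$ $$\Delta_y=\delta_y(x_3',y_3',x_3,y_3)\,\delta_y(x_1,y_1,x_1',y_1')\,\delta_{12}\,\delta_{23}\in R_3.$$ The expressions $(P_1\oplus_0P_2)\oplus_0P_3$ and $P_1\oplus_0(P_2\oplus_0P_3)$ in $A^2$ are the images under $\phi$ of $(z_1\oplus_0z_2)\oplus_0z_3$ and $z_1\oplus_0(z_2\oplus_0z_3)$, whose coordinates lie in $R_3[\frac{1}{\Delta_x\Delta_y}]$; equivalently, they are computed by the formula for $\oplus_0$ with $c,d$ replaced by $\phi(c),\phi(d)$, all denominators being units of $A$. *)

(* Defs.v *)
From HB Require Import structures.
From mathcomp Require Import all_boot all_order all_algebra.
From mathcomp Require Import boolp.
From mathcomp Require Import mpoly ring.

Set Implicit Arguments.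
Unset Strict Implicit.
Unset Printing Implicit Defensive.

Import GRing.Theory.
Local Open Scope ring_scope.

Notation "x %:F" := (@FracField.tofrac _ x) : ring_scope.

Definition map_pair (S T : Type) (f : S -> T) (p : S * S) : T * T :=
  (f p.1, f p.2).

Section Localization.
Variables (R : idomainType) (delta : R).

(* The subring of the fraction field of the elements [p / delta ^ n].  For
   [delta = 0] it would be the image of [R] rather than the zero ring, but it
   is only used at a nonzero element (see [Delta_neq0]). *)
Definition loc_pred : {pred {fraction R}} :=
  fun u => `[< exists (p : R) (n : nat), u = p%:F / delta%:F ^+ n >].

Lemma loc_predP u :
  reflect (exists (p : R) (n : nat), u = p%:F / delta%:F ^+ n) (u \in loc_pred).
Proof. exact: asboolP. Qed.

Lemma loc_subring_closed : subring_closed loc_pred.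
Proof.
split; first by apply/loc_predP; exists 1, 0%N; rewrite expr0 divr1 tofrac1.
- move=> u v /loc_predP[p [n ->]] /loc_predP[q [m ->]]; apply/loc_predP.
  have [d0|dn0] := eqVneq (delta%:F) 0.
    have H (r : R) k : exists s : R, r%:F / 0 ^+ k = s%:F :> {fraction R}.
      case: k => [|k]; first by exists r; rewrite expr0 divr1.
      by exists 0; rewrite exprS mul0r invr0 mulr0 tofrac0.
    rewrite d0; have [s ->] := H p n; have [t ->] := H q m.
    by exists (s - t), 0%N; rewrite expr0 divr1 tofracB.
  exists (p * delta ^+ m - q * delta ^+ n), (n + m)%N.
  rewrite tofracB !tofracM !tofracXn exprD.
  by rewrite -mulNr addf_div ?expf_neq0 // mulNr.
- move=> u v /loc_predP[p [n ->]] /loc_predP[q [m ->]]; apply/loc_predP.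
  exists (p * q), (n + m)%N.
  by rewrite tofracM exprD invfM mulrACA.
Qed.

HB.instance Definition _ :=
  GRing.isSubringClosed.Build {fraction R} loc_pred loc_subring_closed.

Record loc := Loc { loc_val :> {fraction R}; loc_valP : loc_val \in loc_pred }.

HB.instance Definition _ := [isSub for loc_val].
HB.instance Definition _ := [Choice of loc by <:].
HB.instance Definition _ := [SubChoice_isSubComNzRing of loc by <:].

Lemma tofrac_loc (p : R) : p%:F \in loc_pred.
Proof. by apply/loc_predP; exists p, 0%N; rewrite expr0 divr1. Qed.

Definition to_loc (p : R) : loc := Loc (tofrac_loc p).

Lemma to_loc_is_zmod_morphism : zmod_morphism to_loc.
Proof. by move=> p q; apply: val_inj; rewrite /= tofracB. Qed.

Lemma to_loc_is_monoid_morphism : monoid_morphism to_loc.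
Proof. by split=> [|p q]; apply: val_inj; rewrite /= ?tofrac1 ?tofracM. Qed.

HB.instance Definition _ :=
  GRing.isZmodMorphism.Build R loc to_loc to_loc_is_zmod_morphism.
HB.instance Definition _ :=
  GRing.isMonoidMorphism.Build R loc to_loc to_loc_is_monoid_morphism.

Lemma loc_fraction (p q r : R) :
  delta != 0 -> q * r = delta -> p%:F / q%:F \in loc_pred.
Proof.
move=> d0 qr; apply/loc_predP; exists (p * r), 1%N.
move: d0; rewrite -qr mulf_eq0 negb_or => /andP[q0 r0].
by rewrite expr1 !tofracM -mulf_div divff ?mulr1 ?tofrac_eq0.
Qed.

End Localization.

Definition edwards (R : comNzRingType) (c d : R) (p : R * R) : R :=
  p.1 ^+ 2 + c * p.2 ^+ 2 - 1 - d * p.1 ^+ 2 * p.2 ^+ 2.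

Definition delta_x (R : comNzRingType) (d : R) (p q : R * R) : R :=
  1 - d * p.1 * p.2 * q.1 * q.2.

Definition delta_y (R : comNzRingType) (d : R) (p q : R * R) : R :=
  1 + d * p.1 * p.2 * q.1 * q.2.

Definition delta (R : comNzRingType) (d : R) (p q : R * R) : R :=
  delta_x d p q * delta_y d p q.

(* A vanishing denominator yields a junk value; no denominator occurring in
   [sum_12_3], [sum_1_23], [Delta_x_frac] or [Delta_y_frac] vanishes. *)
Definition oplus0 (F : fieldType) (c d : F) (p q : F * F) : F * F :=
  ((p.1 * q.1 - c * p.2 * q.2) / (1 - d * p.1 * q.1 * p.2 * q.2),
   (p.1 * q.2 + p.2 * q.1) / (1 + d * p.1 * q.1 * p.2 * q.2)).

Section Clearing.
Variables (R : comNzRingType) (c d : R).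

Definition num_x (p q : R * R) : R := p.1 * q.1 - c * p.2 * q.2.
Definition num_y (p q : R * R) : R := p.1 * q.2 + p.2 * q.1.

(* [lden true p q r] and [lden false p q r] are [delta p q] times
   [delta_x (p ⊕ q) r] and [delta_y (p ⊕ q) r]. *)
Definition lden (b : bool) (p q r : R * R) : R :=
  delta d p q + (-1) ^+ b * (d * num_x p q * num_y p q * r.1 * r.2).

Definition lnum_x (p q r : R * R) : R :=
  num_x p q * delta_y d p q * r.1 - c * (num_y p q * delta_x d p q) * r.2.
Definition lnum_y (p q r : R * R) : R :=
  num_x p q * delta_y d p q * r.2 + num_y p q * delta_x d p q * r.1.

End Clearing.

Lemma oplus0C (F : fieldType) (c d : F) p q :
  oplus0 c d p q = oplus0 c d q p.
Proof. by rewrite /oplus0; congr (_ / _, _ / _); ring. Qed.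

Section ClearingField.
Variables (F : fieldType) (c d : F) (p q r : F * F).
Hypotheses (dx0 : delta_x d p q != 0) (dy0 : delta_y d p q != 0).

Let dx0' : 1 - d * p.1 * q.1 * p.2 * q.2 != 0.
Proof. by apply: contraNneq dx0 => <-; rewrite /delta_x; apply/eqP; ring. Qed.

Let dy0' : 1 + d * p.1 * q.1 * p.2 * q.2 != 0.
Proof. by apply: contraNneq dy0 => <-; rewrite /delta_y; apply/eqP; ring. Qed.

Lemma delta_x_oplus0 :
  delta_x d (oplus0 c d p q) r * delta d p q = lden c d true p q r.
Proof.
rewrite /delta_x /oplus0 /lden /delta /delta_x /delta_y /num_x /num_y /=.
by field; rewrite dx0' dy0'.
Qed.

Lemma delta_y_oplus0 :
  delta_y d (oplus0 c d p q) r * delta d p q = lden c d false p q r.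
Proof.
rewrite /delta_y /oplus0 /lden /delta /delta_x /delta_y /num_x /num_y /=.
by field; rewrite dx0' dy0'.
Qed.

Hypotheses (lx0 : lden c d true p q r != 0) (ly0 : lden c d false p q r != 0).

Lemma oplus0_oplus0 :
  oplus0 c d (oplus0 c d p q) r =
  (lnum_x c d p q r / lden c d true p q r,
   lnum_y c d p q r / lden c d false p q r).
Proof.
have D0 : delta d p q != 0 by rewrite mulf_neq0.
rewrite -delta_x_oplus0 -delta_y_oplus0.
move: lx0 ly0; rewrite -delta_x_oplus0 -delta_y_oplus0.
rewrite !mulf_eq0 !negb_or => /andP[ex0 _] /andP[ey0 _].
set s := oplus0 c d p q in ex0 ey0 *.
have e1 : s.1 * delta d p q = num_x c p q * delta_y d p q.
  by rewrite /s /delta /delta_x /delta_y /num_x /=; field; rewrite dx0'.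
have e2 : s.2 * delta d p q = num_y p q * delta_x d p q.
  by rewrite /s /delta /delta_x /delta_y /num_y /=; field; rewrite dy0'.
rewrite /lnum_x /lnum_y -e1 -e2 {1}/oplus0.
have -> : 1 - d * s.1 * r.1 * s.2 * r.2 = delta_x d s r.
  by rewrite /delta_x; ring.
have -> : 1 + d * s.1 * r.1 * s.2 * r.2 = delta_y d s r.
  by rewrite /delta_y; ring.
by congr (_, _); field; rewrite ?D0 ?ex0 ?ey0.
Qed.

End ClearingField.

Section ClearingMorphism.
Variables (R S : comNzRingType) (f : {rmorphism R -> S}) (c d : R).
Let f2 := map_pair f.

Lemma rmorph_delta_x p q : f (delta_x d p q) = delta_x (f d) (f2 p) (f2 q).
Proof. by rewrite /delta_x rmorphB !rmorphM rmorph1. Qed.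

Lemma rmorph_delta_y p q : f (delta_y d p q) = delta_y (f d) (f2 p) (f2 q).
Proof. by rewrite /delta_y rmorphD !rmorphM rmorph1. Qed.

Lemma rmorph_delta p q : f (delta d p q) = delta (f d) (f2 p) (f2 q).
Proof. by rewrite /delta rmorphM rmorph_delta_x rmorph_delta_y. Qed.

Lemma rmorph_num_x p q : f (num_x c p q) = num_x (f c) (f2 p) (f2 q).
Proof. by rewrite /num_x rmorphB !rmorphM. Qed.

Lemma rmorph_num_y p q : f (num_y p q) = num_y (f2 p) (f2 q).
Proof. by rewrite /num_y rmorphD !rmorphM. Qed.

Lemma rmorph_lden b p q r :
  f (lden c d b p q r) = lden (f c) (f d) b (f2 p) (f2 q) (f2 r).
Proof.
by rewrite /lden rmorphD rmorph_delta !rmorphM rmorph_sign rmorph_num_x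
  rmorph_num_y.
Qed.

Lemma rmorph_lnum_x p q r :
  f (lnum_x c d p q r) = lnum_x (f c) (f d) (f2 p) (f2 q) (f2 r).
Proof.
by rewrite /lnum_x rmorphB !rmorphM rmorph_num_x rmorph_num_y rmorph_delta_x
  rmorph_delta_y.
Qed.

Lemma rmorph_lnum_y p q r :
  f (lnum_y c d p q r) = lnum_y (f c) (f d) (f2 p) (f2 q) (f2 r).
Proof.
by rewrite /lnum_y rmorphD !rmorphM rmorph_num_x rmorph_num_y rmorph_delta_x
  rmorph_delta_y.
Qed.

End ClearingMorphism.

Lemma delta_xC (R : comNzRingType) (d : R) p q : delta_x d p q = delta_x d q p.
Proof. by rewrite /delta_x; ring. Qed.

Lemma delta_yC (R : comNzRingType) (d : R) p q : delta_y d p q = delta_y d q p.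
Proof. by rewrite /delta_y; ring. Qed.

Section DeltaPoly.
Variables (F : fieldType) (c d : F) (p q r : F * F).
Hypotheses (dx12 : delta_x d p q != 0) (dy12 : delta_y d p q != 0).
Hypotheses (dx23 : delta_x d q r != 0) (dy23 : delta_y d q r != 0).

Lemma delta_x_delta_x :
  delta_x d (oplus0 c d p q) r * delta_x d p (oplus0 c d q r)
    * delta d p q * delta d q r = lden c d true p q r * lden c d true q r p.
Proof. by rewrite -!delta_x_oplus0 // (delta_xC d p); ring. Qed.

Lemma delta_y_delta_y :
  delta_y d (oplus0 c d p q) r * delta_y d p (oplus0 c d q r)
    * delta d p q * delta d q r = lden c d false p q r * lden c d false q r p.
Proof. by rewrite -!delta_y_oplus0 // (delta_yC d p); ring. Qed.

End DeltaPoly.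

Section ClearingFraction.
Variables (R : idomainType) (c d : R) (p q r : R * R).
Let fr : R * R -> {fraction R} * {fraction R} := map_pair (@FracField.tofrac R).

Lemma tofrac_delta_x : (delta_x d p q)%:F = delta_x d%:F (fr p) (fr q).
Proof. exact: (rmorph_delta_x (@FracField.tofrac R)). Qed.

Lemma tofrac_delta_y : (delta_y d p q)%:F = delta_y d%:F (fr p) (fr q).
Proof. exact: (rmorph_delta_y (@FracField.tofrac R)). Qed.

Lemma tofrac_lden b :
  (lden c d b p q r)%:F = lden c%:F d%:F b (fr p) (fr q) (fr r).
Proof. exact: (rmorph_lden (@FracField.tofrac R)). Qed.

Lemma tofrac_lnum_x :
  (lnum_x c d p q r)%:F = lnum_x c%:F d%:F (fr p) (fr q) (fr r).
Proof. exact: (rmorph_lnum_x (@FracField.tofrac R)). Qed.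

Lemma tofrac_lnum_y :
  (lnum_y c d p q r)%:F = lnum_y c%:F d%:F (fr p) (fr q) (fr r).
Proof. exact: (rmorph_lnum_y (@FracField.tofrac R)). Qed.

Hypotheses (dx12 : delta_x d p q != 0) (dy12 : delta_y d p q != 0).

Let dx12' : delta_x d%:F (fr p) (fr q) != 0.
Proof. by rewrite -tofrac_delta_x tofrac_eq0. Qed.

Let dy12' : delta_y d%:F (fr p) (fr q) != 0.
Proof. by rewrite -tofrac_delta_y tofrac_eq0. Qed.

Lemma tofrac_oplus0_oplus0 : (forall b, lden c d b p q r != 0) ->
  oplus0 c%:F d%:F (oplus0 c%:F d%:F (fr p) (fr q)) (fr r) =
  ((lnum_x c d p q r)%:F / (lden c d true p q r)%:F,
   (lnum_y c d p q r)%:F / (lden c d false p q r)%:F).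
Proof.
move=> ld; rewrite oplus0_oplus0 -?tofrac_lden ?tofrac_eq0 //.
by rewrite tofrac_lnum_x tofrac_lnum_y.
Qed.

Hypotheses (dx23 : delta_x d q r != 0) (dy23 : delta_y d q r != 0).

Lemma tofrac_delta_x_delta_x :
  (lden c d true p q r * lden c d true q r p)%:F =
  delta_x d%:F (oplus0 c%:F d%:F (fr p) (fr q)) (fr r)
  * delta_x d%:F (fr p) (oplus0 c%:F d%:F (fr q) (fr r))
  * delta d%:F (fr p) (fr q) * delta d%:F (fr q) (fr r).
Proof.
rewrite delta_x_delta_x -?(rmorph_delta_x (@FracField.tofrac R))
  -?(rmorph_delta_y (@FracField.tofrac R)) ?tofrac_eq0 //.
by rewrite tofracM !(rmorph_lden (@FracField.tofrac R)).
Qed.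

Lemma tofrac_delta_y_delta_y :
  (lden c d false p q r * lden c d false q r p)%:F =
  delta_y d%:F (oplus0 c%:F d%:F (fr p) (fr q)) (fr r)
  * delta_y d%:F (fr p) (oplus0 c%:F d%:F (fr q) (fr r))
  * delta d%:F (fr p) (fr q) * delta d%:F (fr q) (fr r).
Proof.
rewrite delta_y_delta_y -?(rmorph_delta_x (@FracField.tofrac R))
  -?(rmorph_delta_y (@FracField.tofrac R)) ?tofrac_eq0 //.
by rewrite tofracM !(rmorph_lden (@FracField.tofrac R)).
Qed.

End ClearingFraction.

Definition R3 : idomainType := {mpoly {mpoly int[2]}[6]}.
Definition K3 : fieldType := {fraction R3}.

Definition Rc : R3 := ('X_(@Ordinal 2 0 isT) : {mpoly int[2]})%:MP.
Definition Rd : R3 := ('X_(@Ordinal 2 1 isT) : {mpoly int[2]})%:MP.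
Definition z1 : R3 * R3 := ('X_(@Ordinal 6 0 isT), 'X_(@Ordinal 6 1 isT)).
Definition z2 : R3 * R3 := ('X_(@Ordinal 6 2 isT), 'X_(@Ordinal 6 3 isT)).
Definition z3 : R3 * R3 := ('X_(@Ordinal 6 4 isT), 'X_(@Ordinal 6 5 isT)).

Definition Kc : K3 := Rc%:F.
Definition Kd : K3 := Rd%:F.
Definition toK : R3 * R3 -> K3 * K3 := map_pair (@FracField.tofrac R3).

Local Notation "p ⊕ q" := (oplus0 Kc Kd p q) (at level 50, left associativity).

Definition z3' : K3 * K3 := toK z1 ⊕ toK z2.
Definition z1' : K3 * K3 := toK z2 ⊕ toK z3.

Definition Delta_x_frac : K3 :=
  delta_x Kd z3' (toK z3) * delta_x Kd (toK z1) z1'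
  * delta Kd (toK z1) (toK z2) * delta Kd (toK z2) (toK z3).

Definition Delta_y_frac : K3 :=
  delta_y Kd z3' (toK z3) * delta_y Kd (toK z1) z1'
  * delta Kd (toK z1) (toK z2) * delta Kd (toK z2) (toK z3).

Section Eval0.

Definition eval0 (p : R3) : int :=
  meval (fun=> 0) (meval (fun=> 0) (p : {mpoly {mpoly int[2]}[6]})).

Lemma eval0_is_zmod_morphism : zmod_morphism eval0.
Proof. by move=> p q; rewrite /eval0 !mevalB. Qed.

Lemma eval0_is_monoid_morphism : monoid_morphism eval0.
Proof. by split=> [|p q]; rewrite /eval0 ?meval1 ?mevalM. Qed.

HB.instance Definition _ :=
  GRing.isZmodMorphism.Build R3 int eval0 eval0_is_zmod_morphism.
HB.instance Definition _ :=
  GRing.isMonoidMorphism.Build R3 int eval0 eval0_is_monoid_morphism.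

Lemma eval0_neq0 p : eval0 p != 0 -> p != 0.
Proof. by apply: contraNneq => ->; rewrite rmorph0. Qed.

Lemma eval0_Rd : eval0 Rd = 0.
Proof. by rewrite /eval0 mevalC mevalXU. Qed.

Lemma lden_neq0 b p q r : lden Rc Rd b p q r != 0.
Proof.
apply: eval0_neq0; rewrite rmorph_lden /= eval0_Rd /lden /delta /delta_x /delta_y.
by rewrite !mul0r mulr0 subr0 !addr0 mulr1.
Qed.

Lemma delta_x_neq0 p q : delta_x Rd p q != 0.
Proof.
by apply: eval0_neq0; rewrite rmorph_delta_x /= eval0_Rd /delta_x !mul0r.
Qed.

Lemma delta_y_neq0 p q : delta_y Rd p q != 0.
Proof.
by apply: eval0_neq0; rewrite rmorph_delta_y /= eval0_Rd /delta_y !mul0r.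
Qed.

End Eval0.

Definition Delta_x_poly : R3 :=
  lden Rc Rd true z1 z2 z3 * lden Rc Rd true z2 z3 z1.
Definition Delta_y_poly : R3 :=
  lden Rc Rd false z1 z2 z3 * lden Rc Rd false z2 z3 z1.

Lemma Delta_x_polyE : Delta_x_poly%:F = Delta_x_frac.
Proof.
by apply: tofrac_delta_x_delta_x; rewrite ?delta_x_neq0 ?delta_y_neq0.
Qed.

Lemma Delta_y_polyE : Delta_y_poly%:F = Delta_y_frac.
Proof.
by apply: tofrac_delta_y_delta_y; rewrite ?delta_x_neq0 ?delta_y_neq0.
Qed.

Lemma Delta_x_in_R3 : exists p : R3, p%:F == Delta_x_frac.
Proof. by exists Delta_x_poly; rewrite Delta_x_polyE. Qed.

Lemma Delta_y_in_R3 : exists p : R3, p%:F == Delta_y_frac.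
Proof. by exists Delta_y_poly; rewrite Delta_y_polyE. Qed.

(* The polynomials equal to these rational functions, unique since [tofrac] is
   injective; [Delta_xE] and [Delta_yE] give explicit expressions. *)
Definition Delta_x : R3 := xchoose Delta_x_in_R3.
Definition Delta_y : R3 := xchoose Delta_y_in_R3.

Lemma tofrac_Delta_x : Delta_x%:F = Delta_x_frac.
Proof. exact/eqP/(xchooseP Delta_x_in_R3). Qed.

Lemma tofrac_Delta_y : Delta_y%:F = Delta_y_frac.
Proof. exact/eqP/(xchooseP Delta_y_in_R3). Qed.

Lemma Delta_xE : Delta_x = Delta_x_poly.
Proof. by apply/eqP; rewrite -tofrac_eq tofrac_Delta_x Delta_x_polyE. Qed.

Lemma Delta_yE : Delta_y = Delta_y_poly.
Proof. by apply/eqP; rewrite -tofrac_eq tofrac_Delta_y Delta_y_polyE. Qed.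

Lemma Delta_neq0 : Delta_x * Delta_y != 0.
Proof.
by rewrite Delta_xE Delta_yE; do 2?[apply: mulf_neq0]; apply: lden_neq0.
Qed.

Definition R3loc : comNzRingType := loc (Delta_x * Delta_y).
Definition to_R3loc : R3 -> R3loc := to_loc (Delta_x * Delta_y).

Definition sum_12_3 : K3 * K3 := (toK z1 ⊕ toK z2) ⊕ toK z3.
Definition sum_1_23 : K3 * K3 := toK z1 ⊕ (toK z2 ⊕ toK z3).

Lemma sum_12_3E : sum_12_3 =
  ((lnum_x Rc Rd z1 z2 z3)%:F / (lden Rc Rd true z1 z2 z3)%:F,
   (lnum_y Rc Rd z1 z2 z3)%:F / (lden Rc Rd false z1 z2 z3)%:F).
Proof.
apply: tofrac_oplus0_oplus0 => [||b].
- exact: delta_x_neq0.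
- exact: delta_y_neq0.
- exact: lden_neq0.
Qed.

Lemma sum_1_23E : sum_1_23 =
  ((lnum_x Rc Rd z2 z3 z1)%:F / (lden Rc Rd true z2 z3 z1)%:F,
   (lnum_y Rc Rd z2 z3 z1)%:F / (lden Rc Rd false z2 z3 z1)%:F).
Proof.
rewrite /sum_1_23 oplus0C; apply: tofrac_oplus0_oplus0 => [||b].
- exact: delta_x_neq0.
- exact: delta_y_neq0.
- exact: lden_neq0.
Qed.

Fact mulrA4_1 (R : comNzRingType) (a b e : R) : a * (b * e) = a * b * e.
Proof. exact: mulrA. Qed.
Fact mulrA4_2 (R : comNzRingType) (a b e : R) : b * (a * e) = a * b * e.
Proof. by ring. Qed.
Fact mulrA4_3 (R : comNzRingType) (a b e : R) : a * (e * b) = e * (a * b).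
Proof. by ring. Qed.
Fact mulrA4_4 (R : comNzRingType) (a b e : R) : b * (e * a) = e * (a * b).
Proof. by ring. Qed.

Lemma sum_12_3_loc :
  sum_12_3.1 \in loc_pred (Delta_x * Delta_y) /\
  sum_12_3.2 \in loc_pred (Delta_x * Delta_y).
Proof.
have D0 := Delta_neq0; rewrite sum_12_3E; split.
- by apply: (loc_fraction _ D0); rewrite Delta_xE; apply: mulrA4_1.
- by apply: (loc_fraction _ D0); rewrite Delta_yE; apply: mulrA4_3.
Qed.

Lemma sum_1_23_loc :
  sum_1_23.1 \in loc_pred (Delta_x * Delta_y) /\
  sum_1_23.2 \in loc_pred (Delta_x * Delta_y).
Proof.
have D0 := Delta_neq0; rewrite sum_1_23E; split.
- by apply: (loc_fraction _ D0); rewrite Delta_xE; apply: mulrA4_2.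
- by apply: (loc_fraction _ D0); rewrite Delta_yE; apply: mulrA4_4.
Qed.

Definition assoc_l : R3loc * R3loc :=
  (Loc (proj1 sum_12_3_loc), Loc (proj2 sum_12_3_loc)).
Definition assoc_r : R3loc * R3loc :=
  (Loc (proj1 sum_1_23_loc), Loc (proj2 sum_1_23_loc)).

(* Main.v *)
Require Import Defs.
From mathcomp Require Import all_boot all_order all_algebra.
From mathcomp Require Import ring.
Import GRing.Theory.
Local Open Scope ring_scope.

(** Write [p ⊕ q ⊕ r], bracketed to the left, as cleared fractions
    [lnum_x / lden true] and [lnum_y / lden false].  By commutativity of the
    law, the sum bracketed to the right is the same expression in [q], [r],
    [p].  In the localization every [lden] divides [Delta_x * Delta_y] and is
    invertible, so associativity at a point of [A] only asks that the two
    cross products of numerators and denominators have the same image.  These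
    cross products differ by an element of the ideal generated by the three
    curve equations, already over the integers; this is the content of
    [assoc_cross_x] and [assoc_cross_y], where explicit cofactors turn the
    claim into a polynomial identity.

    The cofactors follow a common pattern, which makes them short.  Each one
    is a coordinate of [U z + V J z], with [z] one of the three points and
    [J (x, y) = (c y, - x)] (see [rot_x], [rot_y]); the x and y identities use
    the same [U] and [V], up to a sign at the middle point.  The cross
    difference changes sign when [p] and [r] are exchanged, and the cofactors
    of [edwards p] and [edwards r] are exchanged accordingly.  What
    remains once these two terms are subtracted is divisible by [edwards q],
    and the quotient is its cofactor. *)

Section Cofactors.
Variables (R : comNzRingType) (c d : R).

Definition rot_x (u v : R) (p : R * R) : R := u * p.1 + c * v * p.2.
Definition rot_y (u v : R) (p : R * R) : R := u * p.2 - v * p.1.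

(** Modulo the equations at [q] and [r], the addition law has a second form,
    [num_y q r * (q.1 * r.1 + c * q.2 * r.2) =
     (q.1 * q.2 + r.1 * r.2) * delta_y d q r]
    and
    [num_x q r * (q.1 * r.2 - q.2 * r.1) =
     (r.1 * r.2 - q.1 * q.2) * delta_x d q r].
    Hence the second factors of [outer_u] and [outer_v] become
    [r.1 * r.2 * delta_y d q r] and [r.1 * r.2 * delta_x d q r] there. *)
Definition outer_u (q r : R * R) : R :=
  num_x c q r *
  (num_y q r * (q.1 * r.1 + c * q.2 * r.2) - q.1 * q.2 * delta_y d q r).
Definition outer_v (q r : R * R) : R :=
  num_y q r *
  (num_x c q r * (q.1 * r.2 - q.2 * r.1) + q.1 * q.2 * delta_x d q r).

(** On the curve, [circle p] equals [d * p.1 ^+ 2 * p.2 ^+ 2].  Writing the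
    quotient by [edwards q] with [circle] instead makes its antisymmetry in
    [p] and [r] visible and keeps [d] out of it. *)
Definition circle (p : R * R) : R := p.1 ^+ 2 + c * p.2 ^+ 2 - 1.

Definition middle_u (p r : R * R) : R :=
  (p.1 * p.2 * circle r - r.1 * r.2 * circle p) * (p.1 * r.1 + c * p.2 * r.2).
Definition middle_v (p r : R * R) : R :=
  (p.1 * p.2 * circle r + r.1 * r.2 * circle p) * (p.1 * r.2 - r.1 * p.2).

(** The common factor [d * q.1 * q.2] reflects that both bracketings agree as
    polynomials when [d = 0] (complex-like multiplication) and when [q] lies
    on a coordinate axis, where [⊕ q] is a linear map. *)
Lemma assoc_cross_x (p q r : R * R) :
  lnum_x c d p q r * lden c d true q r p
    - lnum_x c d q r p * lden c d true p q r =
  d * q.1 * q.2 *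
  (rot_x (outer_u q r) (outer_v q r) p * edwards c d p
   + rot_x (middle_u p r) (middle_v p r) q * edwards c d q
   - rot_x (outer_u q p) (outer_v q p) r * edwards c d r).
Proof.
rewrite /lnum_x /lden /rot_x /outer_u /outer_v /middle_u /middle_v /circle.
rewrite /edwards /delta /delta_x /delta_y /num_x /num_y expr1.
ring.
Qed.

Lemma assoc_cross_y (p q r : R * R) :
  lnum_y c d p q r * lden c d false q r p
    - lnum_y c d q r p * lden c d false p q r =
  d * q.1 * q.2 *
  (rot_y (outer_u q r) (outer_v q r) p * edwards c d p
   + rot_y (- middle_u p r) (- middle_v p r) q * edwards c d q
   - rot_y (outer_u q p) (outer_v q p) r * edwards c d r).
Proof.
rewrite /lnum_y /lden /rot_y /outer_u /outer_v /middle_u /middle_v /circle.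
rewrite /edwards /delta /delta_x /delta_y /num_x /num_y expr0.
ring.
Qed.

End Cofactors.

Section LocFractions.
Set Implicit Arguments.
Unset Strict Implicit.
Variables (R : idomainType) (e : R).
Hypothesis e_neq0 : e != 0.

Lemma dvd_tofrac_neq0 (a b : R) : a * b = e -> a%:F != 0.
Proof.
by move=> ab; rewrite tofrac_eq0; apply: contraNneq e_neq0 => a0;
  rewrite -ab a0 mul0r.
Qed.

Lemma to_loc_dvd_inv (a b : R) : a * b = e ->
  exists v : loc e, to_loc e a * v = 1.
Proof.
move=> ab; exists (Loc (loc_fraction 1 e_neq0 ab)).
apply: val_inj; rewrite /= tofrac1 mul1r divff //.
exact: dvd_tofrac_neq0 ab.
Qed.

Lemma loc_fractionE (u : loc e) (m a b : R) :
  a * b = e -> loc_val u = m%:F / a%:F ->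
  u * to_loc e a = to_loc e m.
Proof.
move=> ab uE; apply: val_inj; rewrite /= uE divfK //.
exact: dvd_tofrac_neq0 ab.
Qed.

(** Equality after [phi] is decided by the cross products even though [A] may
    have zero divisors, because the denominators stay invertible in [A]. *)
Lemma rmorph_loc_fraction_eq (A : comNzRingType)
    (phi : {rmorphism loc e -> A}) (u u' : loc e) (m n a b a' b' : R) :
  a * b = e -> a' * b' = e ->
  loc_val u = m%:F / a%:F -> loc_val u' = n%:F / a'%:F ->
  phi (to_loc e (m * a' - n * a)) = 0 ->
  phi u = phi u'.
Proof.
move=> ab ab' uE u'E phi0; apply/subr0_eq.
have [v av] := to_loc_dvd_inv ab; have [v' av'] := to_loc_dvd_inv ab'.
suff -> : phi u - phi u' = phi (to_loc e (m * a' - n * a)) * phi (v * v').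
  by rewrite phi0 mul0r.
rewrite -rmorphB -rmorphM; congr (phi _).
rewrite rmorphB !rmorphM /= -(loc_fractionE ab uE) -(loc_fractionE ab' u'E).
set x := to_loc e a in av *; set x' := to_loc e a' in av' *.
transitivity ((u - u') * (x * v) * (x' * v')); last by ring.
by rewrite av av' !mulr1.
Qed.

Lemma rmorph_loc_ideal0 (A : comNzRingType) (phi : {rmorphism loc e -> A})
    (e1 e2 e3 : R) :
  phi (to_loc e e1) = 0 -> phi (to_loc e e2) = 0 -> phi (to_loc e e3) = 0 ->
  forall k a1 a2 a3 : R,
    phi (to_loc e (k * (a1 * e1 + a2 * e2 - a3 * e3))) = 0.
Proof.
move=> h1 h2 h3 k a1 a2 a3.
by rewrite !(rmorphM, rmorphB, rmorphD) /= h1 h2 h3 !mulr0 addr0 subr0 mulr0.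
Qed.

End LocFractions.

Theorem lemma4 (A : comNzRingType) (phi : {rmorphism R3loc -> A})
  (he1 : phi (to_R3loc (edwards Rc Rd z1)) = 0)
  (he2 : phi (to_R3loc (edwards Rc Rd z2)) = 0)
  (he3 : phi (to_R3loc (edwards Rc Rd z3)) = 0) :
  map_pair phi assoc_l = map_pair phi assoc_r.
Proof.
have D0 := Delta_neq0.
have ideal0 := rmorph_loc_ideal0 he1 he2 he3.
congr (_, _).
- apply: (@rmorph_loc_fraction_eq _ _ D0 A phi assoc_l.1 assoc_r.1
    (lnum_x Rc Rd z1 z2 z3) (lnum_x Rc Rd z2 z3 z1)
    (lden Rc Rd true z1 z2 z3) _ (lden Rc Rd true z2 z3 z1)).
  + by rewrite Delta_xE; apply: mulrA4_1.
  + by rewrite Delta_xE; apply: mulrA4_2.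
  + exact: (congr1 fst sum_12_3E).
  + exact: (congr1 fst sum_1_23E).
  + rewrite assoc_cross_x; exact: ideal0.
- apply: (@rmorph_loc_fraction_eq _ _ D0 A phi assoc_l.2 assoc_r.2
    (lnum_y Rc Rd z1 z2 z3) (lnum_y Rc Rd z2 z3 z1)
    (lden Rc Rd false z1 z2 z3) _ (lden Rc Rd false z2 z3 z1)).
  + by rewrite Delta_yE; apply: mulrA4_3.
  + by rewrite Delta_yE; apply: mulrA4_4.
  + exact: (congr1 snd sum_12_3E).
  + exact: (congr1 snd sum_1_23E).
  + rewrite assoc_cross_y; exact: ideal0.
Qed.
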